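(* Let $p$ be a prime, $u\in\mathbb C\setminus\{0\}$, $n\in\mathbb N$. The set $\{1,\mathbf t_1,g_1,\ldots,g_{n-1}\}$ is a set of topological generators of the $p$-adic Yokonuma–Hecke algebra $\mathrm Y_{\infty,n}(u)$. Moreover, these elements satisfy the following relations: 1. the braid relations among the $g_i$'s: $g_ig_j=g_jg_i$ for $|i-j|>1$ and $g_ig_{i+1}g_i=g_{i+1}g_ig_{i+1}$; 2. $\mathbf t_1g_i=g_i\mathbf t_1$ for $i\ge2$; 3. $\mathbf t_1g_1\mathbf t_1g_1^{-1}=g_1\mathbf t_1g_1^{-1}\mathbf t_1$; 4. $g_i(g_{i-1}\cdots g_1\mathbf t_1g_1^{-1}\cdots g_{i-1}^{-1})g_i^{-1}=g_i^{-1}(g_{i-1}\cdots g_1\mathbf t_1g_1^{-1}\cdots g_{i-1}^{-1})g_i$ for $i=1,\ldots,n-1$; 5. $g_i^2=1+(u-1)e_i(1-g_i)$ for $i=1,\ldots,n-1$.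
   Context: Inverse systems are indexed by $\mathbb N=\{1,2,\ldots\}$; each algebra in the system is discrete and inverse limits carry the subspace topology of the product topology. $C_r=\langle t_r\,;\,t_r^{p^r}=1\rangle$ is cyclic of order $p^r$; $t_{r,i}\in C_r^n$ has $t_r$ in position $i$ and $1$ elsewhere. $B_n$ is the braid group with standard generators $\sigma_1,\ldots,\sigma_{n-1}$; it acts on $C_r^n$ by permuting coordinates via $B_n\to S_n$, $\sigma_i\mapsto(i,i+1)$. The modular framed braid group is $\mathcal F_{p^r,n}=C_r^n\rtimes B_n$ with $(a,\sigma)(b,\tau)=(a\,\sigma(b),\sigma\tau)$. In $\mathbb C\mathcal F_{p^r,n}$ let $$e_{p^r,i}=\frac1{p^r}\sum_{m=1}^{p^r}t_{r,i}^m\,t_{r,i+1}^{-m}.$$ The Yokonuma–Hecke algebra $\mathrm Y_{p^r,n}(u)$ is the quotient of $\mathbb C\mathcal F_{p^r,n}$ by the two-sided ideal generated by $\sigma_i^2-1-(u-1)e_{p^r,i}(1-\sigma_i)$, $i=1,\ldots,n-1$; the image of $\sigma_i$ is denoted $g_i$. For $r\ge s$ the group homomorphism $\mathcal F_{p^r,n}\to\mathcal F_{p^s,n}$, $t_{r,i}\mapsto t_{s,i}$, $\sigma_i\mapsto\sigma_i$, induces an algebra epimorphism $\varphi^r_s:\mathrm Y_{p^r,n}(u)\to\mathrm Y_{p^s,n}(u)$, and $\mathrm Y_{\infty,n}(u):=\varprojlim\mathrm Y_{p^r,n}(u)$. In $\mathrm Y_{\infty,n}(u)$: $g_i^{\pm1}$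 denotes the constant sequence $(g_i^{\pm1},g_i^{\pm1},\ldots)$; $\mathbf t_1$ is the element whose $r$-th component is the image of $t_{r,1}$; $e_i$ is the element whose $r$-th component is the image of $e_{p^r,i}$. A subset $S$ of an inverse limit of algebras is a set of topological generators if the subalgebra generated by $S$ is dense. *)

(* Defs.v *)
From HB Require Import structures.
From mathcomp Require Import all_boot all_algebra perm.
From mathcomp Require Import finmap monalg.
From mathcomp Require Import zify.
From mathcomp Require Import all_classical reals topology.

Set Implicit Arguments.
Unset Strict Implicit.
Unset Printing Implicit Defensive.

Import GRing.Theory Num.Theory Quotient.

Local Open Scope ring_scope.
Local Open Scope quotient_scope.

(** * Groups given by a presentation *)

Section Presentation.
Variables (X : choiceType) (R : seq (X * bool) -> seq (X * bool) -> Prop).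

(* The letter (x, false) stands for x and (x, true) for its inverse. *)
Inductive pres_cong : seq (X * bool) -> seq (X * bool) -> Prop :=
| pres_rel v w of R v w : pres_cong v w
| pres_inv x b : pres_cong [:: (x, b); (x, ~~ b)] [::]
| pres_refl w : pres_cong w w
| pres_sym v w of pres_cong v w : pres_cong w v
| pres_trans v w z of pres_cong v w & pres_cong w z : pres_cong v z
| pres_cat v v' w w' of pres_cong v v' & pres_cong w w' :
    pres_cong (v ++ w) (v' ++ w').

Definition pres_congb v w : bool := `[< pres_cong v w >].

Lemma pres_congb_equiv : equiv_class_of pres_congb.
Proof.
split=> [w|v w|v w z]; first by apply/asboolP; exact: pres_refl.
- by apply/asboolP/asboolP; exact: pres_sym.
- by move=> /asboolP vw /asboolP wz; apply/asboolP; exact: pres_trans vw wz.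
Qed.

Canonical pres_equiv := EquivRelPack pres_congb_equiv.
Canonical pres_encModRel := defaultEncModRel pres_congb.

Definition presented : Type := {eq_quot pres_congb}.
HB.instance Definition _ : EqQuotient _ pres_congb presented :=
  EqQuotient.on presented.
HB.instance Definition _ := Choice.on presented.

Definition pres_of (w : seq (X * bool)) : presented := \pi_presented w.

Lemma pres_of_repr (a : presented) : pres_of (repr a) = a.
Proof. exact: reprK. Qed.

Lemma pres_eq v w : pres_cong v w -> pres_of v = pres_of w.
Proof. by move=> vw; apply/eqP; rewrite /pres_of piE; apply/asboolP. Qed.

Lemma pres_eqP v w : pres_of v = pres_of w -> pres_cong v w.
Proof. by move=> /eqP; rewrite /pres_of piE => /asboolP. Qed.

Lemma pres_repr w : pres_cong (repr (pres_of w)) w.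
Proof. by apply: pres_eqP; rewrite pres_of_repr. Qed.

Definition word_inv (w : seq (X * bool)) := rev [seq (a.1, ~~ a.2) | a <- w].

Lemma word_inv_cat v w : word_inv (v ++ w) = word_inv w ++ word_inv v.
Proof. by rewrite /word_inv map_cat rev_cat. Qed.

Lemma word_invK : involutive word_inv.
Proof.
move=> w; rewrite /word_inv map_rev revK -map_comp -[RHS]map_id.
by apply: eq_map => -[x b] /=; rewrite negbK.
Qed.

Lemma pres_catV w : pres_cong (w ++ word_inv w) [::].
Proof.
elim: w => [|[x b] w IHw]; first exact: pres_refl.
rewrite -cat1s word_inv_cat -catA [w ++ _]catA /=.
apply: pres_trans (pres_inv x b).
apply: (@pres_cat [:: _] [:: _] _ [:: _] (pres_refl _)).
by apply: (@pres_cat _ [::]) => //; exact: pres_refl.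
Qed.

Lemma pres_Vcat w : pres_cong (word_inv w ++ w) [::].
Proof. by rewrite -{2}[w]word_invK; exact: pres_catV. Qed.

Lemma pres_cong_inv v w :
  pres_cong v w -> pres_cong (word_inv v) (word_inv w).
Proof.
move=> vw; rewrite -[word_inv v]cats0.
apply: pres_trans (_ : pres_cong (word_inv v ++ (v ++ word_inv w)) _).
  apply: pres_cat (pres_refl _) _; apply: pres_sym.
  apply: pres_trans (pres_catV w).
  by apply: pres_cat => //; exact: pres_refl.
rewrite catA -[X in pres_cong _ X]cat0s.
by apply: pres_cat (pres_refl _); exact: pres_Vcat.
Qed.

Definition pres_one : presented := pres_of [::].
Definition pres_mul (a b : presented) : presented := pres_of (repr a ++ repr b).
Definition pres_invg (a : presented) : presented := pres_of (word_inv (repr a)).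

Lemma pres_mulE v w : pres_mul (pres_of v) (pres_of w) = pres_of (v ++ w).
Proof. by apply: pres_eq; apply: pres_cat; exact: pres_repr. Qed.

Lemma pres_invgE w : pres_invg (pres_of w) = pres_of (word_inv w).
Proof. by apply/pres_eq/pres_cong_inv/pres_repr. Qed.

Lemma pres_mulA : associative pres_mul.
Proof.
move=> a b c; rewrite -[a]pres_of_repr -[b]pres_of_repr -[c]pres_of_repr.
by rewrite !pres_mulE catA.
Qed.

Lemma pres_mul1 : left_id pres_one pres_mul.
Proof. by move=> a; rewrite -[a]pres_of_repr pres_mulE. Qed.

Lemma pres_mulr1 : right_id pres_one pres_mul.
Proof. by move=> a; rewrite -[a]pres_of_repr pres_mulE cats0. Qed.

Lemma pres_mulV : left_inverse pres_one pres_invg pres_mul.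
Proof.
move=> a; rewrite -[a]pres_of_repr pres_invgE pres_mulE.
by apply: pres_eq; exact: pres_Vcat.
Qed.

Lemma pres_mulrV : right_inverse pres_one pres_invg pres_mul.
Proof.
move=> a; rewrite -[a]pres_of_repr pres_invgE pres_mulE.
by apply: pres_eq; exact: pres_catV.
Qed.

HB.instance Definition _ := isGroup.Build presented
  pres_mulA pres_mul1 pres_mulr1 pres_mulV pres_mulrV.

Definition pres_gen (x : X) : presented := pres_of [:: (x, false)].

Lemma pres_ofM v w : (pres_of v * pres_of w)%g = pres_of (v ++ w).
Proof. exact: pres_mulE. Qed.

Section Lift.
Variables (G : groupType) (f : X -> G).

Definition word_eval (w : seq (X * bool)) : G :=
  (\prod_(a <- w) if a.2 then (f a.1)^-1 else f a.1)%g.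

Definition pres_lift (a : presented) : G := word_eval (repr a).

Hypothesis fR : forall v w, R v w -> word_eval v = word_eval w.

Lemma word_eval_cong v w : pres_cong v w -> word_eval v = word_eval w.
Proof.
elim=> {v w} [v w /fR//|x b|//|v w _ ->//|v w z _ -> _ ->//|v v' w w' _ Ev _ Ew].
  rewrite /word_eval !big_cons !big_nil mulg1 /=.
  by case: b => /=; rewrite ?mulVg ?mulgV.
by rewrite /word_eval !big_cat -!/(word_eval _) Ev Ew.
Qed.

Lemma pres_liftE w : pres_lift (pres_of w) = word_eval w.
Proof. exact/word_eval_cong/pres_repr. Qed.

Lemma pres_lift1 : pres_lift 1%g = 1%g.
Proof. by rewrite pres_liftE /word_eval big_nil. Qed.

Lemma pres_liftM : {morph pres_lift : a b / (a * b)%g}.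
Proof.
move=> a b; rewrite -[a]pres_of_repr -[b]pres_of_repr pres_ofM !pres_liftE.
by rewrite /word_eval big_cat.
Qed.

Lemma pres_lift_gen x : pres_lift (pres_gen x) = f x.
Proof. by rewrite pres_liftE /word_eval big_seq1. Qed.

End Lift.
End Presentation.

(** * The braid group on n strands and its action on coordinates *)

Section Braid.
Variable n : nat.

(* The i-th generator (i : 'I_n.-1) involves the strands i and i + 1. *)
Definition strand (i : 'I_n.-1) : 'I_n := widen_ord (leq_pred n) i.

Fact strandS_subproof (i : 'I_n.-1) : (i.+1 < n)%N.
Proof. by case: n i => [|m] [i ltim] /=. Qed.

Definition strandS (i : 'I_n.-1) : 'I_n := Ordinal (strandS_subproof i).

Inductive braid_rel : seq ('I_n.-1 * bool) -> seq ('I_n.-1 * bool) -> Prop :=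
| braid_comm (i j : 'I_n.-1) of (i.+1 < j)%N :
    braid_rel [:: (i, false); (j, false)] [:: (j, false); (i, false)]
| braid_braid (i j : 'I_n.-1) of j = i.+1 :> nat :
    braid_rel [:: (i, false); (j, false); (i, false)]
              [:: (j, false); (i, false); (j, false)].

Definition braid : Type := presented braid_rel.
HB.instance Definition _ := Group.on braid.

Definition sigma (i : 'I_n.-1) : braid := pres_gen braid_rel i.

Definition transp (i : 'I_n.-1) : 'S_n := tperm (strand i) (strandS i).

Definition braid_perm : braid -> 'S_n := pres_lift transp.

Lemma transp_rel v w :
  braid_rel v w -> word_eval transp v = word_eval transp w.
Proof.
case=> i j ij; rewrite /word_eval !big_cons !big_nil /= !mulg1.
  rewrite conjgC; congr (_ * _)%g; rewrite tpermJ !tpermD //;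
    by apply/eqP=> /(congr1 val) /=; lia.
have jE : strand j = strandS i by apply: val_inj.
have tJ (x y a b : 'I_n) :
    (tperm x y * (tperm a b * tperm x y) = tperm a b ^ tperm x y)%g.
  by rewrite conjgE tpermV.
rewrite !tJ !tpermJ jE tpermR tpermL !tpermD ?[tperm _ _ (strandS i)]tpermL //;
  by apply/eqP=> /(congr1 val) /=; lia.
Qed.

Lemma braid_permM : {morph braid_perm : x y / (x * y)%g}.
Proof. exact: pres_liftM transp_rel. Qed.

Lemma braid_perm1 : braid_perm 1%g = 1%g.
Proof. exact: pres_lift1 transp_rel. Qed.

Lemma braid_perm_sigma i : braid_perm (sigma i) = transp i.
Proof. exact: pres_lift_gen transp_rel i. Qed.

End Braid.

(** * The modular framed braid group *)

Section Framed.
Variables d n : nat.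

(* C_d is written additively as 'Z_d, which is Z/d for d > 1. *)
Record framed := Framed
  { framing : {ffun 'I_n -> 'Z_d}; braiding : braid n }.

Definition framed_pair x := (framing x, braiding x).
Definition pair_framed (x : {ffun 'I_n -> 'Z_d} * braid n) :=
  Framed x.1 x.2.

Lemma framed_pairK : cancel framed_pair pair_framed.
Proof. by case. Qed.

HB.instance Definition _ := Choice.copy framed (can_type framed_pairK).

(* [braid_perm] is a morphism for the composition of 'S_n, which applies the
   left factor first; so [braid_perm s] is the inverse of the image of s under
   the morphism to the symmetric group with the usual composition, and this
   is the left action moving coordinate i to coordinate s(i). *)
Definition braid_act (s : braid n) (a : {ffun 'I_n -> 'Z_d}) :
  {ffun 'I_n -> 'Z_d} := [ffun j => a (braid_perm s j)].

Lemma braid_act1 a : braid_act 1%g a = a.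
Proof. by apply/ffunP=> j; rewrite ffunE braid_perm1 perm1. Qed.

Lemma braid_actM s t a :
  braid_act (s * t)%g a = braid_act s (braid_act t a).
Proof. by apply/ffunP=> j; rewrite !ffunE braid_permM permM. Qed.

Lemma braid_actD s : {morph braid_act s : a b / a + b}.
Proof. by move=> a b; apply/ffunP=> j; rewrite !ffunE. Qed.

Lemma braid_actN s : {morph braid_act s : a / - a}.
Proof. by move=> a; apply/ffunP=> j; rewrite !ffunE. Qed.

Lemma braid_act0 s : braid_act s 0 = 0.
Proof. by apply/ffunP=> j; rewrite !ffunE. Qed.

Definition framed_one := Framed 0 1%g.
Definition framed_mul (x y : framed) :=
  Framed (framing x + braid_act (braiding x) (framing y))
         (braiding x * braiding y)%g.
Definition framed_inv (x : framed) :=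
  Framed (- braid_act (braiding x)^-1%g (framing x)) (braiding x)^-1%g.

Lemma framed_mulA : associative framed_mul.
Proof.
move=> x y z; rewrite /framed_mul /=.
by rewrite braid_actD braid_actM addrA mulgA.
Qed.

Lemma framed_mul1 : left_id framed_one framed_mul.
Proof. by move=> [a s]; rewrite /framed_mul /= add0r mul1g braid_act1. Qed.

Lemma framed_mulr1 : right_id framed_one framed_mul.
Proof. by move=> [a s]; rewrite /framed_mul /= braid_act0 addr0 mulg1. Qed.

Lemma framed_mulV : left_inverse framed_one framed_inv framed_mul.
Proof. by move=> [a s]; rewrite /framed_mul /= addNr mulVg. Qed.

Lemma framed_mulrV : right_inverse framed_one framed_inv framed_mul.
Proof.
move=> [a s]; rewrite /framed_mul /= braid_actN -braid_actM mulgV.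
by rewrite braid_act1 addrN.
Qed.

HB.instance Definition _ := isGroup.Build framed
  framed_mulA framed_mul1 framed_mulr1 framed_mulV framed_mulrV.

Definition framed_t (i : 'I_n) : framed :=
  Framed [ffun j => (j == i)%:R] 1%g.

Definition framed_sigma (i : 'I_n.-1) : framed := Framed 0 (sigma i).

Lemma framed_tX i m :
  (framed_t i ^+ m)%g = Framed [ffun j => (j == i)%:R *+ m] 1%g.
Proof.
elim: m => [|m IHm].
  by congr Framed; apply/ffunP=> j; rewrite !ffunE mulr0n.
rewrite expgS IHm; congr Framed; last exact: mulg1.
by rewrite braid_act1; apply/ffunP=> j; rewrite !ffunE mulrS.
Qed.

End Framed.

(* The reduction Z/d -> Z/e; it is used when e divides d. *)
Definition Zp_red d e (a : 'Z_d) : 'Z_e := (val a)%:R.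

Definition framed_red d e n (x : framed d n) : framed e n :=
  Framed [ffun j => Zp_red e (framing x j)] (braiding x).

(* The second alternative is e | d for nontrivial moduli; the first one only
   makes all pairs of powers p ^ r, p ^ s with s <= r admissible, even for p
   not prime. *)
Definition moduli (d e : nat) : bool :=
  (e == d) || [&& 1 < e, 0 < d & e %| d]%N.

Lemma moduli_expn p r s : (s <= r)%N -> moduli (p ^ r.+1) (p ^ s.+1).
Proof.
move=> sr; rewrite /moduli; case: p => [|[|p]].
- by rewrite !exp0n // eqxx.
- by rewrite !exp1n eqxx.
- rewrite dvdn_exp2l ?ltnS // expn_gt0 /= andbT -{1}(exp1n s.+1).
  by rewrite ltn_exp2r // orbT.
Qed.

Section Reduction.
Variables (d e n : nat) (de : moduli d e).

Lemma Zp_red_nat m : Zp_red e (m%:R : 'Z_d) = m%:R.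
Proof.
rewrite /Zp_red; case/orP: de => [/eqP ed|/and3P[e1 d0 ed]].
  by rewrite -ed; rewrite natr_Zp.
have d1 : (1 < d)%N := leq_trans e1 (dvdn_leq d0 ed).
apply: val_inj; rewrite /= !val_Zp_nat //.
by rewrite modn_dvdm.
Qed.

Lemma Zp_redD : {morph @Zp_red d e : a b / a + b}.
Proof.
move=> a b; rewrite -[a]natr_Zp -[b]natr_Zp -natrD.
by rewrite !Zp_red_nat natrD.
Qed.

Lemma framed_red1 : framed_red e (1 : framed d n)%g = 1%g.
Proof.
by congr Framed; apply/ffunP=> j; rewrite !ffunE -[0]/(0%:R) Zp_red_nat.
Qed.

Lemma framed_redM : {morph @framed_red d e n : x y / (x * y)%g}.
Proof.
by move=> x y; congr Framed; apply/ffunP=> j; rewrite !ffunE Zp_redD.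
Qed.

Lemma framed_red_t i : framed_red e (framed_t d i) = framed_t e i :> framed e n.
Proof. by congr Framed; apply/ffunP=> j; rewrite !ffunE Zp_red_nat. Qed.

Lemma framed_red_sigma i :
  framed_red e (framed_sigma d i) = framed_sigma e i :> framed e n.
Proof.
by congr Framed; apply/ffunP=> j; rewrite !ffunE -[0]/(0%:R) Zp_red_nat.
Qed.

End Reduction.

(** * Group algebras *)

(* [{malg K[G]}] is the free K-module on G; it is a ring in the library only
   for monoids without nontrivial units. *)
Definition group_alg (K : fieldType) (G : groupType) : Type := {malg K[G]}.

HB.instance Definition _ K G := Choice.on (group_alg K G).

(* The module operations are those of [{malg K[G]}], locked. *)
HB.lock Definition galg_zero (K : fieldType) (G : groupType) :
  group_alg K G := 0 : {malg K[G]}.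
HB.lock Definition galg_opp (K : fieldType) (G : groupType)
  (x : {malg K[G]}) : group_alg K G := - x.
HB.lock Definition galg_add (K : fieldType) (G : groupType)
  (x y : {malg K[G]}) : group_alg K G := x + y.
HB.lock Definition galg_scale (K : fieldType) (G : groupType)
  (a : K) (x : {malg K[G]}) : group_alg K G := a *: x.

Section GroupAlgebraModule.
Variables (K : fieldType) (G : groupType).
Local Notation A := (group_alg K G).
Local Notation add := (@galg_add K G : A -> A -> A).
Local Notation scale := (@galg_scale K G : K -> A -> A).

Fact galg_addA : associative add.
Proof. by move=> x y z; rewrite galg_add.unlock addrA. Qed.
Fact galg_addC : commutative add.
Proof. by move=> x y; rewrite galg_add.unlock addrC. Qed.
Fact galg_add0 : left_id (galg_zero K G) add.
Proof. by move=> x; rewrite galg_add.unlock galg_zero.unlock add0r. Qed.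
Fact galg_addN : left_inverse (galg_zero K G) (@galg_opp K G) add.
Proof.
move=> x; rewrite galg_add.unlock galg_zero.unlock galg_opp.unlock.
exact: addNr.
Qed.

HB.instance Definition _ :=
  GRing.isZmodule.Build A galg_addA galg_addC galg_add0 galg_addN.

Fact galg_scaleA a b x : scale a (scale b x) = scale (a * b) x.
Proof. by rewrite galg_scale.unlock scalerA. Qed.
Fact galg_scale1 : left_id 1 scale.
Proof. by move=> x; rewrite galg_scale.unlock scale1r. Qed.
Fact galg_scaleDr : right_distributive scale +%R.
Proof.
move=> a x y; rewrite -[_ + _]/(add _ _) -[RHS]/(add _ _).
by rewrite galg_scale.unlock galg_add.unlock scalerDr.
Qed.
Fact galg_scaleDl x : {morph scale^~ x : a b / a + b}.
Proof.
move=> a b; rewrite -[RHS]/(add _ _).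
by rewrite galg_scale.unlock galg_add.unlock scalerDl.
Qed.

HB.instance Definition _ := GRing.Zmodule_isLmodule.Build K A
  galg_scaleA galg_scale1 galg_scaleDr galg_scaleDl.

Lemma galg_malg0 : (0 : A) = (0 : {malg K[G]}).
Proof. by rewrite -[LHS]/(galg_zero K G) galg_zero.unlock. Qed.

Lemma galg_malgP a (x y : A) :
  a *: x + y = (a *: (x : {malg K[G]}) + (y : {malg K[G]})).
Proof.
rewrite -[LHS]/(add (scale a x) y).
by rewrite galg_scale.unlock galg_add.unlock.
Qed.

End GroupAlgebraModule.

HB.lock Definition gelt (K : fieldType) (G : groupType) (g : G) :
  group_alg K G := << g >>.
Arguments gelt {K G} g%_group_scope.
Canonical gelt_unlockable := Unlockable gelt.unlock.

Section GroupAlgebra.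
Variables (K : fieldType) (G : groupType).

Local Notation gelt := (@gelt K G).
Local Notation A := (group_alg K G).
Implicit Types (x y z : A) (g h : G).

Definition galg_ext (B : lmodType K) (f : G -> B) (x : A) : B :=
  \sum_(g <- msupp x) x@_g *: f g.

Lemma galg_extw (B : lmodType K) (f : G -> B) (D : {fset G}) x :
  (msupp x `<=` D)%fset -> galg_ext f x = \sum_(g <- D) x@_g *: f g.
Proof.
move=> xD; apply: big_fset_incl => // g _ /mcoeff_outdom ->.
by rewrite scale0r.
Qed.

Lemma galg_ext_is_linear (B : lmodType K) (f : G -> B) :
  linear (galg_ext f : A -> B).
Proof.
move=> a x y; pose D := (msupp x `|` msupp y)%fset.
have xD : (msupp x `<=` D)%fset by exact: fsubsetUl.
have yD : (msupp y `<=` D)%fset by exact: fsubsetUr.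
have axyD : (msupp (a *: (x : {malg K[G]}) + (y : {malg K[G]})) `<=` D)%fset.
  apply: fsubset_trans (msuppD_le _ _) _.
  by rewrite fsubUset yD andbT (fsubset_trans (msuppZ_le _ _) xD).
rewrite galg_malgP !(galg_extw f xD, galg_extw f yD, galg_extw f axyD).
rewrite scaler_sumr -big_split /=; apply: eq_bigr => g _.
by rewrite mcoeffD mcoeffZ scalerDl scalerA.
Qed.

HB.instance Definition _ (B : lmodType K) (f : G -> B) :=
  GRing.isLinear.Build K A B *:%R (galg_ext f) (@galg_ext_is_linear B f).

Lemma galg_ext_gelt (B : lmodType K) (f : G -> B) g :
  galg_ext f (gelt g) = f g.
Proof.
by rewrite unlock (galg_extw f msuppU_le) big_seq_fset1 mcoeffUU scale1r.
Qed.

Lemma galg_ind (P : A -> Prop) :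
  P 0 -> (forall a g x, P x -> P (a *: gelt g + x)) -> forall x, P x.
Proof.
move=> P0 PD x; rewrite [x]monalgE.
elim: (enum_fset _) => [|g s IHs]; first by rewrite big_nil -galg_malg0.
rewrite big_cons (_ : << x@_g *g g >> = x@_g *: (gelt g : {malg K[G]})).
  by rewrite -galg_malgP; exact: PD.
by rewrite unlock; apply/malgP=> h; rewrite mcoeffZ !mcoeffU mulr_natr.
Qed.

Lemma galg_linear_ext (B : lmodType K) (f f' : {linear A -> B}) :
  (forall g, f (gelt g) = f' (gelt g)) -> f =1 f'.
Proof.
move=> ff'; elim/galg_ind => [|a g x IHx]; first by rewrite !linear0.
by rewrite !linearP ff' IHx.
Qed.

Definition galg_one : A := gelt 1%g.
End GroupAlgebra.

HB.lock Definition galg_mul (K : fieldType) (G : groupType)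
    (x y : group_alg K G) : group_alg K G :=
  galg_ext (fun g => galg_ext (fun h => gelt (g * h)%g) y) x.
Arguments galg_mul {K G} x y.
Canonical galg_mul_unlockable := Unlockable galg_mul.unlock.

Section GroupAlgebraRing.
Variables (K : fieldType) (G : groupType).
Local Notation gelt := (@gelt K G).
Local Notation A := (group_alg K G).
Local Notation galg_mul := (@galg_mul K G).
Local Notation galg_one := (@galg_one K G).
Implicit Types (x y z : A) (g h : G).

Lemma galg_mul_linearr x : linear (galg_mul x).
Proof.
move=> a y y'; rewrite unlock /galg_ext scaler_sumr -big_split /=.
apply: eq_bigr => g _; rewrite -!/(galg_ext _ _) linearP scalerDr !scalerA.
by rewrite mulrC.
Qed.

Lemma galg_mul_gelt g h : galg_mul (gelt g) (gelt h) = gelt (g * h)%g.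
Proof. by rewrite unlock !galg_ext_gelt. Qed.

Lemma galg_mulDl : left_distributive galg_mul +%R.
Proof. by move=> x y z; rewrite unlock linearD. Qed.

Lemma galg_mulDr : right_distributive galg_mul +%R.
Proof.
by move=> x y z; rewrite -{1}[y]scale1r galg_mul_linearr scale1r.
Qed.

Lemma galg_mul0l y : galg_mul 0 y = 0.
Proof. by rewrite unlock linear0. Qed.

Lemma galg_mul0r x : galg_mul x 0 = 0.
Proof. by apply: (@addrI _ (galg_mul x 0)); rewrite -galg_mulDr !addr0. Qed.

Lemma galg_mulZl a x y : galg_mul (a *: x) y = a *: galg_mul x y.
Proof. by rewrite unlock linearZ. Qed.

Lemma galg_mulZr a x y : galg_mul x (a *: y) = a *: galg_mul x y.
Proof. by rewrite -[a *: y]addr0 galg_mul_linearr galg_mul0r addr0. Qed.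

Lemma galg_mulA : associative galg_mul.
Proof.
elim/galg_ind => [|a g x IHx] y z; first by rewrite 3!galg_mul0l.
rewrite 3!galg_mulDl 3!galg_mulZl IHx.
suff -> : galg_mul (gelt g) (galg_mul y z) = galg_mul (galg_mul (gelt g) y) z
  by [].
move=> {x IHx}.
elim/galg_ind: y => [|b h y IHy].
  by rewrite galg_mul0l galg_mul0r galg_mul0l.
rewrite galg_mulDl 2!galg_mulDr galg_mulDl galg_mulZl 2!galg_mulZr galg_mulZl.
rewrite IHy.
suff -> : galg_mul (gelt g) (galg_mul (gelt h) z) =
          galg_mul (galg_mul (gelt g) (gelt h)) z by [].
move=> {y IHy}.
elim/galg_ind: z => [|c k z IHz]; first by rewrite 3!galg_mul0r.
by rewrite 3!galg_mulDr 3!galg_mulZr IHz !galg_mul_gelt mulgA.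
Qed.

Lemma galg_mul1 : left_id galg_one galg_mul.
Proof.
elim/galg_ind => [|a g x IHx]; first by rewrite galg_mul0r.
by rewrite galg_mulDr galg_mulZr IHx galg_mul_gelt mul1g.
Qed.

Lemma galg_mulr1 : right_id galg_one galg_mul.
Proof.
elim/galg_ind => [|a g x IHx]; first by rewrite galg_mul0l.
by rewrite galg_mulDl galg_mulZl IHx galg_mul_gelt mulg1.
Qed.

Lemma galg_one_neq0 : galg_one != 0.
Proof.
rewrite /(@galg_one) unlock galg_malg0; apply/eqP=> /(congr1 (mcoeff 1%g)) /eqP.
by rewrite mcoeff0 mcoeffUU oner_eq0.
Qed.

HB.instance Definition _ := GRing.Zmodule_isNzRing.Build A
  galg_mulA galg_mul1 galg_mulr1 galg_mulDl galg_mulDr galg_one_neq0.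
HB.instance Definition _ := GRing.Lmodule_isLalgebra.Build K A
  (fun a x y => esym (galg_mulZl a x y)).
HB.instance Definition _ := GRing.Lalgebra_isAlgebra.Build K A
  (fun a x y => esym (galg_mulZr a x y)).

Lemma gelt1 : gelt 1%g = 1.
Proof. by []. Qed.

Lemma geltM : {morph gelt : g h / (g * h)%g >-> g * h}.
Proof. by move=> g h; rewrite -galg_mul_gelt. Qed.

Section Ext.
Variables (B : algType K) (f : G -> B).
Hypotheses (f1 : f 1%g = 1) (fM : {morph f : g h / (g * h)%g >-> g * h}).

Lemma galg_ext_monoid : monoid_morphism (galg_ext f : A -> B).
Proof.
split; first by rewrite -gelt1 galg_ext_gelt.
elim/galg_ind => [|a g x IHx] y; first by rewrite mul0r !linear0 mul0r.
rewrite mulrDl !linearD /= IHx mulrDl; congr (_ + _).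
rewrite -scalerAl !linearZ /= -scalerAl; congr (_ *: _).
elim/galg_ind: y => [|b h y IHy]; first by rewrite mulr0 !linear0 mulr0.
rewrite mulrDr !linearD /= IHy mulrDr; congr (_ + _).
by rewrite -scalerAr !linearZ /= -scalerAr -geltM !galg_ext_gelt fM.
Qed.
End Ext.
End GroupAlgebraRing.


(** * Quotients of algebras by two-sided ideals *)

(* The ideal is proper because algebras are nontrivial rings in the library. *)
HB.mixin Record isProperTwoSided (R : nzRingType) (I : R -> bool) := {
  ideal2_neq1 : 1 \notin I;
  ideal2_mul : forall a b x, x \in I -> a * x * b \in I
}.

HB.structure Definition Ideal2 (R : nzRingType) :=
  {I of GRing.ZmodClosed R I & isProperTwoSided R I}.

Definition quot_alg (K : fieldType) (A : algType K) (I : Ideal2.type A) : Type :=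
  Quotient.quot I.

Section QuotAlg.
Variables (K : fieldType) (A : algType K) (I : Ideal2.type A).
Local Notation Q := (quot_alg I).

HB.instance Definition _ := GRing.Zmodule.on Q.

Definition quot_pi (x : A) : Q := \pi_(Quotient.quot I) x.

Definition quot_repr (q : Q) : A := repr (q : Quotient.quot I).

Lemma quot_reprK : cancel quot_repr quot_pi.
Proof. exact: reprK. Qed.

Lemma quot_eqP x y : reflect (quot_pi x = quot_pi y) (x - y \in I).
Proof. by rewrite idealrBE; apply: eqP. Qed.

Lemma quot_piB : zmod_morphism quot_pi.
Proof. exact: (pi_is_zmod_morphism (Quotient.quot I)). Qed.

HB.instance Definition _ := GRing.isZmodMorphism.Build A Q quot_pi quot_piB.

Lemma quot_pi_eq0 x : (quot_pi x == 0) = (x \in I).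
Proof.
rewrite -(raddf0 quot_pi) -[in RHS](subr0 x).
by apply/eqP/idP => /quot_eqP.
Qed.

Lemma ideal2_mull a x : x \in I -> a * x \in I.
Proof. by move=> Ix; rewrite -[a * x]mulr1 ideal2_mul. Qed.

Lemma ideal2_mulr a x : x \in I -> x * a \in I.
Proof. by move=> Ix; rewrite -[x]mul1r ideal2_mul. Qed.

Lemma quot_repr_pi x : quot_repr (quot_pi x) - x \in I.
Proof. by apply/quot_eqP; rewrite quot_reprK. Qed.

Definition quot_one : Q := quot_pi 1.
Definition quot_mul (p q : Q) : Q := quot_pi (quot_repr p * quot_repr q).
Definition quot_scale (a : K) (q : Q) : Q := quot_pi (a *: quot_repr q).

Lemma quot_mulE x y : quot_mul (quot_pi x) (quot_pi y) = quot_pi (x * y).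
Proof.
apply/quot_eqP; set x' := quot_repr _; set y' := quot_repr _.
rewrite (_ : _ - _ = (x' - x) * y' + x * (y' - y)); last first.
  by rewrite mulrBl mulrBr addrA subrK.
by apply: rpredD; [exact/ideal2_mulr/quot_repr_pi | exact/ideal2_mull/quot_repr_pi].
Qed.

Lemma quot_scaleE a x : quot_scale a (quot_pi x) = quot_pi (a *: x).
Proof.
apply/quot_eqP; rewrite -scalerBr -[X in a *: X]mul1r scalerAl.
exact/ideal2_mull/quot_repr_pi.
Qed.

Lemma quot_mulA : associative quot_mul.
Proof.
move=> x y z; rewrite -[x]quot_reprK -[y]quot_reprK -[z]quot_reprK.
by rewrite !quot_mulE mulrA.
Qed.

Lemma quot_mul1 : left_id quot_one quot_mul.
Proof. by move=> x; rewrite -[x]quot_reprK quot_mulE mul1r. Qed.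

Lemma quot_mulr1 : right_id quot_one quot_mul.
Proof. by move=> x; rewrite -[x]quot_reprK quot_mulE mulr1. Qed.

Lemma quot_mulDl : left_distributive quot_mul +%R.
Proof.
move=> x y z; rewrite -[x]quot_reprK -[y]quot_reprK -[z]quot_reprK.
by rewrite -raddfD !quot_mulE -raddfD mulrDl.
Qed.

Lemma quot_mulDr : right_distributive quot_mul +%R.
Proof.
move=> x y z; rewrite -[x]quot_reprK -[y]quot_reprK -[z]quot_reprK.
by rewrite -raddfD !quot_mulE -raddfD mulrDr.
Qed.

Lemma quot_one_neq0 : quot_one != 0.
Proof. by rewrite quot_pi_eq0 ideal2_neq1. Qed.

HB.instance Definition _ := GRing.Zmodule_isNzRing.Build Q
  quot_mulA quot_mul1 quot_mulr1 quot_mulDl quot_mulDr quot_one_neq0.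

Lemma quot_scaleA a b x :
  quot_scale a (quot_scale b x) = quot_scale (a * b) x.
Proof. by rewrite -[x]quot_reprK !quot_scaleE scalerA. Qed.

Lemma quot_scale1 : left_id 1 quot_scale.
Proof. by move=> x; rewrite -[x]quot_reprK quot_scaleE scale1r. Qed.

Lemma quot_scaleDr : right_distributive quot_scale +%R.
Proof.
move=> a x y; rewrite -[x]quot_reprK -[y]quot_reprK.
by rewrite -raddfD !quot_scaleE -raddfD scalerDr.
Qed.

Lemma quot_scaleDl x : {morph quot_scale^~ x : a b / a + b}.
Proof.
by move=> a b; rewrite -[x]quot_reprK !quot_scaleE -raddfD scalerDl.
Qed.

HB.instance Definition _ := GRing.Zmodule_isLmodule.Build K Q
  quot_scaleA quot_scale1 quot_scaleDr quot_scaleDl.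

Lemma quot_scalerAl (a : K) (x y : Q) : a *: (x * y) = (a *: x) * y.
Proof.
rewrite -[x]quot_reprK -[y]quot_reprK.
change (quot_scale a (quot_mul (quot_pi (quot_repr x)) (quot_pi (quot_repr y)))
  = quot_mul (quot_scale a (quot_pi (quot_repr x))) (quot_pi (quot_repr y))).
by rewrite quot_mulE !quot_scaleE quot_mulE scalerAl.
Qed.

HB.instance Definition _ := GRing.Lmodule_isLalgebra.Build K Q quot_scalerAl.

Lemma quot_scalerAr (a : K) (x y : Q) : a *: (x * y) = x * (a *: y).
Proof.
rewrite -[x]quot_reprK -[y]quot_reprK.
change (quot_scale a (quot_mul (quot_pi (quot_repr x)) (quot_pi (quot_repr y)))
  = quot_mul (quot_pi (quot_repr x)) (quot_scale a (quot_pi (quot_repr y)))).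
by rewrite quot_mulE !quot_scaleE quot_mulE scalerAr.
Qed.

HB.instance Definition _ := GRing.Lalgebra_isAlgebra.Build K Q quot_scalerAr.

Lemma quot_pi_monoid : monoid_morphism quot_pi.
Proof. by split=> // x y; rewrite -quot_mulE. Qed.

Lemma quot_piZ : scalable quot_pi.
Proof. by move=> a x; rewrite -quot_scaleE. Qed.

HB.instance Definition _ :=
  GRing.isMonoidMorphism.Build A Q quot_pi quot_pi_monoid.
HB.instance Definition _ := GRing.isScalable.Build K A Q *:%R quot_pi quot_piZ.

Section Lift.
Variables (B : algType K) (f : {lrmorphism A -> B}).
Hypothesis fI : forall x, x \in I -> f x = 0.

Definition quot_lift (_ : forall x, x \in I -> f x = 0) (q : Q) : B :=
  f (quot_repr q).

Lemma quot_liftE x : quot_lift fI (quot_pi x) = f x.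
Proof.
have /eqP := fI (quot_repr_pi x).
by rewrite raddfB subr_eq0 => /eqP.
Qed.

Lemma quot_lift_linear : linear (quot_lift fI).
Proof.
move=> a x y; rewrite -[x]quot_reprK -[y]quot_reprK.
by rewrite -linearP !quot_liftE linearP.
Qed.

Lemma quot_lift_monoid : monoid_morphism (quot_lift fI).
Proof.
split; first by rewrite -(rmorph1 quot_pi) quot_liftE rmorph1.
move=> x y; rewrite -[x]quot_reprK -[y]quot_reprK.
by rewrite -rmorphM !quot_liftE rmorphM.
Qed.

HB.instance Definition _ :=
  GRing.isLinear.Build K Q B *:%R (quot_lift fI) quot_lift_linear.
HB.instance Definition _ :=
  GRing.isMonoidMorphism.Build Q B (quot_lift fI) quot_lift_monoid.
End Lift.
End QuotAlg.

Arguments quot_pi {K A} I x.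

Section GeneratedIdeal.
Variable R : nzRingType.

Definition two_sided (I : set R) : Prop :=
  [/\ I 0, forall x y, I x -> I y -> I (x - y) &
      forall a b x, I x -> I (a * x * b)].

Definition gen_ideal (S : set R) : {pred R} :=
  [pred x | `[< smallest two_sided S x >]].

Lemma gen_idealP S x : reflect (smallest two_sided S x) (x \in gen_ideal S).
Proof. exact: asboolP. Qed.

Lemma mem_gen_ideal (S : set R) x : S x -> x \in gen_ideal S.
Proof. by move=> Sx; apply/gen_idealP; exact: sub_gen_smallest. Qed.

Lemma gen_ideal_ind (S P : set R) :
  two_sided P -> (forall x, S x -> P x) -> forall x, x \in gen_ideal S -> P x.
Proof. by move=> tP SP x /gen_idealP; apply; split. Qed.

Lemma gen_ideal_zmod S : zmod_closed (gen_ideal S).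
Proof.
split=> [|x y /gen_idealP Ix /gen_idealP Iy]; apply/gen_idealP => P [tP SP].
  by case: tP.
by case: (tP) => _ + _; apply; [exact: Ix | exact: Iy].
Qed.

Lemma gen_ideal_mul S a b x : x \in gen_ideal S -> a * x * b \in gen_ideal S.
Proof.
move=> /gen_idealP Ix; apply/gen_idealP => P [tP SP].
by case: (tP) => _ _; apply; exact: Ix.
Qed.

End GeneratedIdeal.

(** * The Yokonuma-Hecke algebra *)

Section Yokonuma.
Variables (K : numFieldType) (d n : nat) (u : K).
Local Notation A := (group_alg K (framed d n)).

Definition framed_idem (i : 'I_n.-1) : A :=
  d%:R^-1 *: \sum_(1 <= m < d.+1)
    gelt (framed_t d (strand i) ^+ m * framed_t d (strandS i) ^- m)%g.

Definition yok_rel (i : 'I_n.-1) : A :=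
  let s := gelt (framed_sigma d i) in
  s ^+ 2 - 1 - (u - 1) *: (framed_idem i * (1 - s)).

Definition yok_ideal : {pred A} := gen_ideal (range yok_rel).

Definition galg_aug : A -> K^o := galg_ext (fun=> 1 : K^o).

Lemma galg_aug_monoid : monoid_morphism galg_aug.
Proof. by apply: galg_ext_monoid => // x y; rewrite mulr1. Qed.

HB.instance Definition _ := GRing.Linear.on galg_aug.
HB.instance Definition _ :=
  GRing.isMonoidMorphism.Build A K^o galg_aug galg_aug_monoid.

Lemma galg_aug_ideal x : x \in yok_ideal -> galg_aug x = 0.
Proof.
move: x; apply: gen_ideal_ind => [|_ [i _ <-]].
  split=> [|x y /= x0 y0|a b x /= x0]; first exact: raddf0.
    by rewrite raddfB /= x0 y0 subrr.
  by rewrite !rmorphM /= x0 mulr0 mul0r.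
rewrite /yok_rel !raddfB /= rmorphXn /= linearZ /= rmorphM raddfB /=.
by rewrite rmorph1 [galg_aug _]galg_ext_gelt expr1n !subrr mulr0 scaler0 subrr.
Qed.

Lemma yok_ideal_neq1 : 1 \notin yok_ideal.
Proof.
by apply/negP => /galg_aug_ideal /eqP; rewrite rmorph1 oner_eq0.
Qed.

HB.instance Definition _ :=
  GRing.isZmodClosed.Build A yok_ideal (gen_ideal_zmod (range yok_rel)).
HB.instance Definition _ := isProperTwoSided.Build A yok_ideal
  yok_ideal_neq1 (fun a b x => @gen_ideal_mul A (range yok_rel) a b x).

Definition yokonuma : Type := quot_alg yok_ideal.
HB.instance Definition _ := GRing.Algebra.on yokonuma.

Definition yok_pi : {lrmorphism A -> yokonuma} := quot_pi yok_ideal.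

Lemma yok_pi_rel i : yok_pi (yok_rel i) = 0.
Proof. by apply/eqP; rewrite quot_pi_eq0 mem_gen_ideal //; exists i. Qed.

End Yokonuma.
Arguments yok_pi {K d n} u.
Arguments yok_ideal {K} d n u.
Arguments yok_rel {K} d {n} u i.
Arguments framed_idem K d {n} i.
Arguments yokonuma {K} d n u.

Lemma sum_periodic (K : fieldType) (V : lmodType K) (F : nat -> V) e q :
    (forall m, F (m + e)%N = F m) ->
  \sum_(1 <= m < (q * e).+1) F m = q%:R *: \sum_(1 <= m < e.+1) F m.
Proof.
move=> Fper; have Fperq m k : F (m + k * e)%N = F m.
  by elim: k => [|k IHk]; rewrite ?addn0 // mulSn addnCA addnC Fper.
elim: q => [|q IHq]; first by rewrite mul0n big_geq // scale0r.
rewrite mulSn addnC (@big_cat_nat _ _ _ (q * e).+1) ?ltnS ?leq_addr //= IHq.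
rewrite -natr1 scalerDl scale1r; congr (_ + _).
rewrite -[(q * e).+1]add1n big_addn (_ : ((q * e + e).+1 - q * e)%N = e.+1); last by lia.
by apply: eq_bigr => m _; exact: Fperq.
Qed.

Section YokonumaReduction.
Variables (K : numFieldType) (d e n : nat) (u : K) (de : moduli d e).
Local Notation A d := (group_alg K (framed d n)).

Definition galg_red (_ : moduli d e) : A d -> A e :=
  galg_ext (fun x => gelt (framed_red e x)).

Lemma galg_red_monoid : monoid_morphism (galg_red de).
Proof.
apply: galg_ext_monoid => [|x y]; first by rewrite framed_red1.
by rewrite framed_redM // geltM.
Qed.

HB.instance Definition _ := GRing.Linear.on (galg_red de).
HB.instance Definition _ :=
  GRing.isMonoidMorphism.Build (A d) (A e) (galg_red de) galg_red_monoid.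

Lemma galg_red_gelt x : galg_red de (gelt x) = gelt (framed_red e x).
Proof. exact: galg_ext_gelt. Qed.

Lemma framed_redX (x : framed d n) m :
  framed_red e (x ^+ m)%g = (framed_red e x ^+ m)%g.
Proof.
elim: m => [|m IHm]; first exact: framed_red1.
by rewrite !expgS framed_redM // IHm.
Qed.

Lemma framed_redV (x : framed d n) :
  framed_red e (x^-1)%g = ((framed_red e x)^-1)%g.
Proof.
apply: (mulgI (framed_red e x)).
by rewrite -framed_redM // !mulgV framed_red1.
Qed.

Lemma framed_t_exp i : (1 < e)%N -> (framed_t e i ^+ e)%g = 1%g :> framed e n.
Proof.
move=> e1; rewrite framed_tX; congr Framed; apply/ffunP=> j; rewrite !ffunE.
by rewrite -mulr_natr pchar_Zp // mulr0.
Qed.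

Lemma galg_red_idem i :
  galg_red de (framed_idem K d i) = framed_idem K e i.
Proof.
rewrite /framed_idem linearZ /= (raddf_sum (galg_red de)).
rewrite [X in _ *: X = _](eq_bigr (fun m => gelt (framed_t e (strand i) ^+ m *
    framed_t e (strandS i) ^- m)%g)) => [|m _]; last first.
  rewrite /= galg_red_gelt framed_redM // framed_redV !framed_redX.
  by rewrite !framed_red_t.
case/orP: (de) => [/eqP -> //|/and3P[e1 d0 /dvdnP[k dE]]].
set F := fun m => gelt (K := K)
  (framed_t e (strand i) ^+ m * framed_t e (strandS i) ^- m)%g.
have Fper m : F (m + e)%N = F m.
  by rewrite /F !expgnDr !framed_t_exp // !mulg1.
rewrite dE (@sum_periodic _ _ F _ _ Fper) scalerA natrM invfM -mulrA mulrC -mulrA.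
by rewrite mulfV ?mulr1 // pnatr_eq0; case: k dE d0 => // ->.
Qed.

Lemma galg_red_rel i : galg_red de (yok_rel d u i) = yok_rel e u i.
Proof.
rewrite /yok_rel !raddfB /= rmorphXn linearZ /= rmorphM raddfB /=.
by rewrite (rmorph1 (galg_red de)) galg_red_gelt framed_red_sigma // galg_red_idem.
Qed.

Definition yok_galg_red : {lrmorphism A d -> yokonuma e n u} :=
  yok_pi u \o galg_red de.

Lemma yok_galg_red_ideal x : x \in yok_ideal d n u -> yok_galg_red x = 0.
Proof.
move: x; apply: gen_ideal_ind => [|_ [i _ <-]].
  split=> [|x y /= x0 y0|a b x /= x0]; first by rewrite !raddf0.
    by rewrite !raddfB /= x0 y0 subrr.
  by rewrite !rmorphM /= x0 mulr0 mul0r.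
by rewrite /= galg_red_rel yok_pi_rel.
Qed.

Definition yok_red : {lrmorphism yokonuma d n u -> yokonuma e n u} :=
  quot_lift yok_galg_red_ideal.

Lemma yok_redE x : yok_red (yok_pi u x) = yok_pi u (galg_red de x).
Proof. exact: quot_liftE. Qed.

End YokonumaReduction.

(** * Inverse limits of discrete algebras *)

Section InverseLimit.
Variables (K : fieldType) (Y : nat -> algType K).
Variable (phi : forall r s, (s <= r)%N -> {lrmorphism Y r -> Y s}).

Definition coherent (x : forall r, Y r) : Prop :=
  forall r s (sr : (s <= r)%N), phi sr (x r) = x s.

Record invlim := InvLim
  { invlim_val :> forall r, Y r; _ : `[< coherent invlim_val >] }.

HB.instance Definition _ := [isSub for invlim_val].
HB.instance Definition _ := [Choice of invlim by <:].

Definition mk_invlim x (cx : coherent x) : invlim := InvLim (asboolT cx).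

Lemma invlimP (x : invlim) : coherent x.
Proof. exact/asboolP/(valP x). Qed.

Lemma invlim_ext (x y : invlim) : (forall r, x r = y r) -> x = y.
Proof. by move=> xy; apply: val_inj; apply: functional_extensionality_dep. Qed.

Fact coherent0 : coherent (fun=> 0). Proof. by move=> *; rewrite raddf0. Qed.
Fact coherentN (x : invlim) : coherent (fun r => - x r).
Proof. by move=> *; rewrite raddfN /= invlimP. Qed.
Fact coherentD (x y : invlim) : coherent (fun r => x r + y r).
Proof. by move=> *; rewrite raddfD /= !invlimP. Qed.
Fact coherent1 : coherent (fun=> 1). Proof. by move=> *; rewrite rmorph1. Qed.
Fact coherentM (x y : invlim) : coherent (fun r => x r * y r).
Proof. by move=> *; rewrite rmorphM /= !invlimP. Qed.
Fact coherentZ a (x : invlim) : coherent (fun r => a *: x r).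
Proof. by move=> *; rewrite linearZ /= invlimP. Qed.

Definition invlim0 := mk_invlim coherent0.
Definition invlimN x := mk_invlim (coherentN x).
Definition invlimD x y := mk_invlim (coherentD x y).
Definition invlim1 := mk_invlim coherent1.
Definition invlimM x y := mk_invlim (coherentM x y).
Definition invlimZ a x := mk_invlim (coherentZ a x).

Fact invlim_addA : associative invlimD.
Proof. by move=> x y z; apply: invlim_ext => r; exact: addrA. Qed.
Fact invlim_addC : commutative invlimD.
Proof. by move=> x y; apply: invlim_ext => r; exact: addrC. Qed.
Fact invlim_add0 : left_id invlim0 invlimD.
Proof. by move=> x; apply: invlim_ext => r; exact: add0r. Qed.
Fact invlim_addN : left_inverse invlim0 invlimN invlimD.
Proof. by move=> x; apply: invlim_ext => r; exact: addNr. Qed.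

HB.instance Definition _ := GRing.isZmodule.Build invlim
  invlim_addA invlim_addC invlim_add0 invlim_addN.

Fact invlim_mulA : associative invlimM.
Proof. by move=> x y z; apply: invlim_ext => r; exact: mulrA. Qed.
Fact invlim_mul1 : left_id invlim1 invlimM.
Proof. by move=> x; apply: invlim_ext => r; exact: mul1r. Qed.
Fact invlim_mulr1 : right_id invlim1 invlimM.
Proof. by move=> x; apply: invlim_ext => r; exact: mulr1. Qed.
Fact invlim_mulDl : left_distributive invlimM +%R.
Proof. by move=> x y z; apply: invlim_ext => r; exact: mulrDl. Qed.
Fact invlim_mulDr : right_distributive invlimM +%R.
Proof. by move=> x y z; apply: invlim_ext => r; exact: mulrDr. Qed.
Fact invlim1_neq0 : invlim1 != 0.
Proof.
apply/eqP=> /(congr1 (fun x : invlim => x 0%N)) /eqP.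
by rewrite /= oner_eq0.
Qed.

HB.instance Definition _ := GRing.Zmodule_isNzRing.Build invlim
  invlim_mulA invlim_mul1 invlim_mulr1 invlim_mulDl invlim_mulDr invlim1_neq0.

Fact invlim_scaleA a b x : invlimZ a (invlimZ b x) = invlimZ (a * b) x.
Proof. by apply: invlim_ext => r; exact: scalerA. Qed.
Fact invlim_scale1 : left_id 1 invlimZ.
Proof. by move=> x; apply: invlim_ext => r; exact: scale1r. Qed.
Fact invlim_scaleDr : right_distributive invlimZ +%R.
Proof. by move=> a x y; apply: invlim_ext => r; exact: scalerDr. Qed.
Fact invlim_scaleDl x : {morph invlimZ^~ x : a b / a + b}.
Proof. by move=> a b; apply: invlim_ext => r; exact: scalerDl. Qed.

HB.instance Definition _ := GRing.Zmodule_isLmodule.Build K invlim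
  invlim_scaleA invlim_scale1 invlim_scaleDr invlim_scaleDl.

Fact invlim_scalerAl (a : K) (x y : invlim) : a *: (x * y) = (a *: x) * y.
Proof. by apply: invlim_ext => r; exact: scalerAl. Qed.

HB.instance Definition _ :=
  GRing.Lmodule_isLalgebra.Build K invlim invlim_scalerAl.

Fact invlim_scalerAr (a : K) (x y : invlim) : a *: (x * y) = x * (a *: y).
Proof. by apply: invlim_ext => r; exact: scalerAr. Qed.

HB.instance Definition _ :=
  GRing.Lalgebra_isAlgebra.Build K invlim invlim_scalerAr.

(* The subspace topology of the product of the discrete spaces Y r. *)
Definition invlim_prod (x : invlim) :
  prod_topology (fun r => discrete_topology (Y r)) := invlim_val x.

HB.instance Definition _ :=
  Topological.copy invlim (initial_topology invlim_prod).

Definition gen_subalg (S : set invlim) : set invlim :=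
  smallest (fun B => GRing.subalg_closed [in B]) S.

Definition topological_generators (S : set invlim) : Prop :=
  dense (gen_subalg S).

End InverseLimit.

(** * The p-adic Yokonuma-Hecke algebra *)

Section YokonumaInf.
Variables (K : numFieldType) (p n : nat) (u : K).

(* The index r : nat stands for the exponent r.+1, so that the exponents
   range over the positive integers. *)
Definition yok_tower (r : nat) : algType K := yokonuma (p ^ r.+1) n u.

Definition yok_phi r s (sr : (s <= r)%N) :
  {lrmorphism yok_tower r -> yok_tower s} := yok_red n u (moduli_expn p sr).

Definition yokonuma_inf : Type := invlim yok_phi.
HB.instance Definition _ := GRing.Algebra.on yokonuma_inf.

Fact yinf_g_coherent (i : 'I_n.-1) : coherent yok_phi
  (fun r => yok_pi u (gelt (framed_sigma (p ^ r.+1) i))).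
Proof.
move=> r s sr; rewrite /yok_phi yok_redE galg_red_gelt.
by rewrite framed_red_sigma // moduli_expn.
Qed.

Fact yinf_gV_coherent (i : 'I_n.-1) : coherent yok_phi
  (fun r => yok_pi u (gelt (framed_sigma (p ^ r.+1) i)^-1%g)).
Proof.
move=> r s sr; rewrite /yok_phi yok_redE galg_red_gelt.
by rewrite framed_redV ?framed_red_sigma // moduli_expn.
Qed.

Fact yinf_t_coherent (j : 'I_n) : coherent yok_phi
  (fun r => yok_pi u (gelt (framed_t (p ^ r.+1) j))).
Proof.
move=> r s sr; rewrite /yok_phi yok_redE galg_red_gelt.
by rewrite framed_red_t // moduli_expn.
Qed.

Fact yinf_e_coherent (i : 'I_n.-1) : coherent yok_phi
  (fun r => yok_pi u (framed_idem K (p ^ r.+1) i)).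
Proof. by move=> r s sr; rewrite /yok_phi yok_redE galg_red_idem. Qed.

Definition yinf_g i : yokonuma_inf := mk_invlim (yinf_g_coherent i).
Definition yinf_gV i : yokonuma_inf := mk_invlim (yinf_gV_coherent i).
Definition yinf_t j : yokonuma_inf := mk_invlim (yinf_t_coherent j).
Definition yinf_e i : yokonuma_inf := mk_invlim (yinf_e_coherent i).

Lemma yinf_gK i : yinf_g i * yinf_gV i = 1.
Proof.
apply: invlim_ext => r /=.
rewrite -[LHS](rmorphM (yok_pi u)) -geltM mulgV.
exact: (rmorph1 (yok_pi u)).
Qed.

Lemma yinf_gVK i : yinf_gV i * yinf_g i = 1.
Proof.
apply: invlim_ext => r /=.
rewrite -[LHS](rmorphM (yok_pi u)) -geltM mulVg.
exact: (rmorph1 (yok_pi u)).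
Qed.

End YokonumaInf.

(* Main.v *)
Require Import Defs.
From mathcomp Require Import all_boot all_algebra perm.
From mathcomp Require Import all_classical reals topology.
From mathcomp Require Import complex.

Set Implicit Arguments.
Unset Strict Implicit.
Unset Printing Implicit Defensive.

Import GRing.Theory Num.Theory.
Local Open Scope classical_set_scope.
Local Open Scope ring_scope.

(** The relations are checked on each component of the inverse limit.  The
    quadratic one is the defining relation of the algebra; the others are
    images of identities of the modular framed braid group, where
    s_i t_j = t_(s_i j) s_i.  In particular the iterated conjugate
    g_(i-1) .. g_1 t_1 g_1^-1 .. g_(i-1)^-1 is t_i, and conjugating it by g_i
    or by g_i^-1 gives t_(i+1) in both cases, because a transposition is its
    own inverse.

    For density, it suffices that at each level r every element of the algebra
    is the r-th component of an element of the generated subalgebra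
    ([dense_of_levelwise]): by coherence, agreement at level r gives agreement
    at all lower levels, so approximants at levels 0, 1, 2, ... converge
    coordinatewise.  Each level is spanned by images of the framed braid
    group, which is generated by the t_j, the s_i and the inverses of the s_i
    ([framed_ind]).  It remains to obtain the inverses of the g_i and all the
    t_j from t_1 and the g_i alone.

    Expressing the inverse of g_i through g_i and e_i would be circular, since
    e_i involves t_i and t_(i+1).  But e_i can be eliminated: as it is
    idempotent, multiplying the quadratic relation on the right by g_i gives
    (g_i^2 - 1) g_i = - u (g_i^2 - 1), and then, since u is nonzero, the
    inverse of g_i is u^-1 (g_i^2 - 1) + g_i ([quadratic_inv]).  The other
    framing generators follow from t_(i+1) = g_i t_i g_i^-1 by induction. *)

(** * Inverting a solution of the quadratic relation *)

(** With x = e (1 - g), the relation says that g^2 - 1 is (u - 1) x; by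
    idempotency it also gives e g^2 = e + (u - 1) x, hence
    x g = e g - e g^2 = - x - (u - 1) x = - u x. *)
Lemma quadratic_mulr (K : fieldType) (A : algType K) (u : K) (e g : A) :
    e * e = e -> g ^+ 2 = 1 + (u - 1) *: (e * (1 - g)) ->
  (g ^+ 2 - 1) * g = - u *: (g ^+ 2 - 1).
Proof.
move=> ee gg; rewrite gg addrC addKr.
have eg2 : e * g ^+ 2 = e + (u - 1) *: (e * (1 - g)).
  by rewrite gg mulrDr mulr1 -scalerAr mulrA ee.
have xg : e * (1 - g) * g = - u *: (e * (1 - g)).
  have -> : e * (1 - g) * g = - (e * (1 - g)) - (u - 1) *: (e * (1 - g)).
    rewrite -mulrA mulrBl mul1r -expr2 [LHS]mulrBr eg2 opprD addrA.
    by congr (_ - _); rewrite mulrBr mulr1 opprB.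
  by rewrite scalerBl scale1r opprB addrA addNr add0r scaleNr.
by rewrite -scalerAl xg scalerA scalerA mulrC.
Qed.

(** The point of this formula is that e does not occur in it: right
    multiplication of [quadratic_mulr] by the inverse h of g turns it into
    g^2 - 1 = - u (g - h). *)
Lemma quadratic_inv (K : fieldType) (A : algType K) (u : K) (e g h : A) :
    u != 0 -> e * e = e -> g ^+ 2 = 1 + (u - 1) *: (e * (1 - g)) ->
    g * h = 1 ->
  h = u^-1 *: (g ^+ 2 - 1) + g.
Proof.
move=> u0 ee gg gh.
have /(congr1 ( *%R^~ h)) := quadratic_mulr ee gg.
rewrite -mulrA gh mulr1 -scalerAl mulrBl mul1r expr2 -(mulrA g) gh mulr1 => ->.
by rewrite scalerA mulrN mulVf // scaleN1r opprB subrK.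
Qed.

(** * Density in an inverse limit of discrete algebras *)

Section InverseLimitDensity.
Variables (K : fieldType) (Y : nat -> algType K).
Variable (phi : forall r s, (s <= r)%N -> {lrmorphism Y r -> Y s}).
Local Notation L := (invlim phi).
Implicit Types (S D : set L) (x y : L).

Lemma gen_subalg_sub S x : S x -> gen_subalg S x.
Proof. by move=> Sx B [_ SB]; exact: SB. Qed.

Lemma gen_subalg1 S : gen_subalg S 1.
Proof. by move=> B [[B1 _ _] _]; rewrite -in_setE. Qed.

Lemma gen_subalgP S a x y :
  gen_subalg S x -> gen_subalg S y -> gen_subalg S (a *: x + y).
Proof.
move=> Sx Sy B BS; have [[_ lB _] _] := BS.
by rewrite -in_setE; apply: lB; rewrite in_setE; [exact: Sx | exact: Sy].
Qed.

Lemma gen_subalgM S x y :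
  gen_subalg S x -> gen_subalg S y -> gen_subalg S (x * y).
Proof.
move=> Sx Sy B BS; have [[_ _ mB] _] := BS.
by rewrite -in_setE; apply: mB; rewrite in_setE; [exact: Sx | exact: Sy].
Qed.

Lemma gen_subalg0 S : gen_subalg S 0.
Proof.
have := gen_subalgP (-1) (@gen_subalg1 S) (@gen_subalg1 S).
by rewrite scaleN1r addNr.
Qed.

Lemma gen_subalgX S x m : gen_subalg S x -> gen_subalg S (x ^+ m).
Proof.
move=> Sx; elim: m => [|m IHm]; first exact: gen_subalg1.
by rewrite exprS; exact: gen_subalgM.
Qed.

(** The indices are linearly ordered, so a basic open set of the product
    constrains no more than the component at the largest index involved. *)
Lemma dense_of_levelwise D :
  (forall r x, exists2 z, D z & (z : L) r = x r) -> dense D.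
Proof.
move=> Dx O [x Ox] [V oV VO].
have /choice[z zP] : forall r, exists z : L, D z /\ z r = x r.
  by move=> r; have [z] := Dx r x; exists z.
have zx : ((fun r => invlim_prod (z r)) @ \oo --> invlim_prod x).
  (* The s-th coordinates of the z r are equal to that of x once s <= r. *)
  apply/cvg_sup => s W [_ [[B _ <-] Bx] BW].
  exists s => // r /= sr; apply: BW => /=.
  suff E : invlim_prod (z r) s = invlim_prod x s by rewrite /= E.
  by rewrite /invlim_prod -!(invlimP _ sr); congr (phi sr _); case: (zP r).
have Vx : V (invlim_prod x) by rewrite -VO in Ox.
have [r _ /(_ r (leqnn r)) Vr] := zx V (open_nbhs_nbhs (conj oV Vx)).
by exists (z r); split; [rewrite -VO | case: (zP r)].
Qed.
End InverseLimitDensity.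

(** * The modular framed braid group *)

Section FramedGroup.
Variables d n : nat.
Implicit Types (i : 'I_n.-1) (j k : 'I_n).
Local Notation t := (@framed_t d n).
Local Notation s := (@framed_sigma d n).

Lemma framed_tC j k : (t j * t k = t k * t j)%g.
Proof. by congr Framed; rewrite !braid_act1 addrC. Qed.

Lemma framed0M (x y : braid n) :
  (Framed 0 x * Framed 0 y)%g = Framed 0 (x * y)%g :> framed d n.
Proof. by congr Framed; rewrite braid_act0 addr0. Qed.

Lemma framed_sigma_t i j : (s i * t j = t (transp i j) * s i)%g.
Proof.
congr Framed; last by rewrite /= mulg1 mul1g.
rewrite /= braid_act0 addr0 add0r; apply/ffunP=> k; rewrite !ffunE.
by rewrite braid_perm_sigma -(inj_eq (@perm_inj _ (transp i)) k) tpermK.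
Qed.

Lemma framed_sigma_comm (i j : 'I_n.-1) :
  (i.+1 < j)%N -> (s i * s j = s j * s i)%g.
Proof.
move=> ij; rewrite !framed0M; congr Framed.
rewrite !(@pres_ofM _ _ [:: _] [:: _]).
by apply/pres_eq/pres_rel; exact: braid_comm.
Qed.

Lemma framed_sigma_braid (i j : 'I_n.-1) :
  j = i.+1 :> nat -> (s i * s j * s i = s j * s i * s j)%g.
Proof.
move=> ij; rewrite !framed0M; congr Framed.
rewrite !(@pres_ofM _ _ [:: _] [:: _]) !(@pres_ofM _ _ [:: _; _] [:: _]).
by apply/pres_eq/pres_rel; exact: braid_braid.
Qed.

(** Generation of the group by the t_j and the s_i, in the form of an
    induction principle.  Inverses of the t_j are not listed, because these
    elements have finite order, unlike the s_i. *)
Lemma framed_ind (P : framed d n -> Prop) :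
    P 1%g -> (forall x y, P x -> P y -> P (x * y)%g) ->
    (forall j, P (t j)) -> (forall i, P (s i)) -> (forall i, P (s i)^-1%g) ->
  forall x, P x.
Proof.
move=> P1 PM Pt Ps PsV [a b].
have -> : Framed a b = (Framed a 1 * Framed 0 b)%g.
  by congr Framed; rewrite /= ?braid_act0 ?addr0 ?mul1g.
apply: (PM).
  (* A framing a is the product of the powers t_j ^+ a_j. *)
  pose f (c : {ffun 'I_n -> 'Z_d}) : framed d n := Framed c 1%g.
  have fM : {morph f : c c' / c + c' >-> (c * c')%g}.
    by move=> c c'; congr Framed; rewrite /= ?braid_act1 ?mul1g.
  have -> : a = \sum_j [ffun k => (k == j)%:R *+ a j].
    apply/ffunP=> k; rewrite sum_ffunE (bigD1 k) //= ffunE eqxx natr_Zp.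
    rewrite big1 ?addr0 // => j jk; rewrite ffunE eq_sym (negPf jk) mul0rn //.
  rewrite -[Framed _ _]/(f _) (big_morph f fM (erefl _)).
  apply: (big_ind P P1 PM) => j _; rewrite /f -framed_tX.
  by elim: (nat_of_ord _) => // m IHm; rewrite expgS; exact: PM.
rewrite -[b]pres_of_repr; elim: (repr b) => [//|x w IHw].
rewrite -cat1s -pres_ofM -framed0M; apply: PM IHw.
case: x => i []; last exact: Ps.
have <- : ((s i)^-1 =
    Framed 0 (pres_of (braid_rel (n := n)) [:: (i, true)]))%g.
  congr Framed; rewrite /= ?braid_act0 ?oppr0 //.
  exact: (pres_invgE _ [:: _]).
exact: PsV.
Qed.
End FramedGroup.

(** * Idempotency of the elements e_i *)

Section Idempotent.
Variables (K : numFieldType) (d n : nat).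

(** Up to the factor 1/d, this element is the sum S of the powers of
    z = t_i t_(i+1)^-1, which satisfies z^d = 1; thus z S = S and S S = d S.
    The bound on d is there because ['Z_d] is Z/2 for d = 1. *)
Lemma framed_idem_idem (i : 'I_n.-1) : (1 < d)%N ->
  framed_idem K d i * framed_idem K d i = framed_idem K d i.
Proof.
move=> d1; pose z := (framed_t d (strand i) * (framed_t d (strandS i))^-1)%g.
pose F m : group_alg K (framed d n) := gelt (z ^+ m)%g.
have eE : framed_idem K d i = d%:R^-1 *: \sum_(1 <= m < d.+1) F m.
  rewrite /framed_idem; congr (_ *: _); apply: eq_bigr => m _.
  by rewrite /F expgnFl //; exact: framed_tC.
have zd : (z ^+ d = 1)%g.
  by rewrite expgnFl ?framed_t_exp ?divg1 //; exact: framed_tC.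
pose S := \sum_(1 <= m < d.+1) F m.
have zS : F 1%N * S = S.
  rewrite mulr_sumr (eq_bigr (fun m => F m.+1)) => [|m _]; last first.
    by rewrite /F -geltM expg1 -expgS.
  (* Adding F 1 on both sides avoids splitting the sums: both become the sum
     of F from 1 to d + 1, by F (d + 1) = F 1. *)
  apply: (@addrI _ (F 1%N)).
  have /esym -> : \sum_(1 <= m < d.+2) F m =
      F 1%N + \sum_(1 <= m < d.+1) F m.+1.
    exact: big_nat_recl.
  by rewrite big_nat_recr //= addrC /F expgS zd mulg1 expg1.
have zmS m : F m * S = S.
  elim: m => [|m IHm]; first by rewrite /F expg0 gelt1 mul1r.
  by rewrite /F expgS geltM -mulrA IHm -[in gelt z](expg1 z).
rewrite eE -scalerAl -scalerAr mulr_suml (eq_bigr _ (fun m _ => zmS m)).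
rewrite sumr_const_nat subn1 /= -scaler_nat [X in _ *: X]scalerA.
rewrite mulVf ?scale1r //.
by rewrite pnatr_eq0 -lt0n ltnW.
Qed.
End Idempotent.

(** Used to peel the outermost conjugation off an iterated conjugate of t_1. *)
Lemma filter_enum_ord_ltnS m (i : 'I_m) :
  [seq j : 'I_m <- enum 'I_m | (j < i.+1)%N] =
  rcons [seq j : 'I_m <- enum 'I_m | (j < i)%N] i.
Proof.
have E k : (k <= m)%N ->
    [seq val j | j <- enum 'I_m & (val j < k)%N] = iota 0 k.
  by move=> km; rewrite -(@filter_iota_ltn 0 m k) // -val_enum_ord filter_map.
apply: (inj_map val_inj); rewrite map_rcons !E ?(ltnW (ltn_ord i)) //.
by rewrite -addn1 iotaD cats1.
Qed.

(** * The Yokonuma-Hecke algebra at one level *)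

Section YokonumaLevel.
Variables (K : numFieldType) (d n : nat) (u : K).

Definition yok_elt (x : framed d n) : yokonuma d n u := yok_pi u (gelt x).

Lemma yok_elt1 : yok_elt 1%g = 1.
Proof. exact: (rmorph1 (yok_pi u)). Qed.

Lemma yok_eltM : {morph yok_elt : x y / (x * y)%g >-> x * y}.
Proof. by move=> x y; rewrite /yok_elt geltM rmorphM. Qed.

Lemma yok_quadratic i (g := yok_elt (framed_sigma d i)) :
  g ^+ 2 = 1 + (u - 1) *: (yok_pi u (framed_idem K d i) * (1 - g)).
Proof.
have /eqP := yok_pi_rel d u i.
rewrite /yok_rel !raddfB /= rmorphXn linearZ /= rmorphM raddfB /= rmorph1.
by rewrite -addrA -opprD subr_eq0 => /eqP.
Qed.

Lemma yok_span (P : yokonuma d n u -> Prop) :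
    P 0 -> (forall a x y, P x -> P y -> P (a *: x + y)) ->
    (forall h, P (yok_elt h)) ->
  forall y, P y.
Proof.
move=> P0 PD Ph y; rewrite -[y]quot_reprK.
rewrite -[quot_pi _ _]/(yok_pi u (quot_repr y)).
elim/galg_ind: (quot_repr y) => [|a h x IHx]; first by rewrite raddf0.
by rewrite linearP; apply: PD IHx; exact: Ph.
Qed.
End YokonumaLevel.

(** * Relations and generators in the p-adic Yokonuma-Hecke algebra *)

Section YokonumaInf.
Variables (K : numFieldType) (p n : nat) (u : K).
Hypotheses (p_pr : prime p) (u0 : u != 0) (n_gt0 : (0 < n)%N).
Local Notation Y := (yokonuma_inf p n u).
Local Notation g := (@yinf_g K p n u).
Local Notation gV := (@yinf_gV K p n u).
Local Notation t := (@yinf_t K p n u).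
Local Notation e := (@yinf_e K p n u).
Local Notation d := (fun r => p ^ r.+1)%N.
Implicit Types (i : 'I_n.-1) (j k : 'I_n) (r : nat).

Lemma yinf_gE i r : (g i : Y) r = yok_elt u (framed_sigma (d r) i).
Proof. by []. Qed.
Lemma yinf_gVE i r : (gV i : Y) r = yok_elt u (framed_sigma (d r) i)^-1%g.
Proof. by []. Qed.
Lemma yinf_tE j r : (t j : Y) r = yok_elt u (framed_t (d r) j).
Proof. by []. Qed.
Lemma yinfM (x y : Y) r : (x * y) r = x r * y r.
Proof. by []. Qed.
Let yinfE := (yinfM, yinf_gE, yinf_gVE, yinf_tE).

Lemma yinf_g_comm (i j : 'I_n.-1) :
  (i.+1 < j)%N \/ (j.+1 < i)%N -> g i * g j = g j * g i.
Proof.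
move=> ij; apply: invlim_ext => r; rewrite !yinfE -!yok_eltM.
by case: ij => ij; rewrite (framed_sigma_comm _ ij).
Qed.

Lemma yinf_g_braid (i j : 'I_n.-1) :
  j = i.+1 :> nat -> g i * g j * g i = g j * g i * g j.
Proof.
move=> ij; apply: invlim_ext => r; rewrite !yinfE -!yok_eltM.
by rewrite framed_sigma_braid.
Qed.

Lemma yinf_g_t i j : g i * t j = t (transp i j) * g i.
Proof.
by apply: invlim_ext => r; rewrite !yinfE -!yok_eltM framed_sigma_t.
Qed.

Lemma yinf_g_conj i j : g i * t j * gV i = t (transp i j).
Proof. by rewrite yinf_g_t -mulrA yinf_gK mulr1. Qed.

Lemma yinf_gV_conj i j : gV i * t j * g i = t (transp i j).
Proof.
rewrite -mulrA -{1}[j](tpermK (strand i) (strandS i)) -yinf_g_t mulrA.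
by rewrite yinf_gVK mul1r.
Qed.

Lemma yinf_tC j k : t j * t k = t k * t j.
Proof. by apply: invlim_ext => r; rewrite !yinfE -!yok_eltM framed_tC. Qed.

Lemma yinf_quadratic i : g i ^+ 2 = 1 + (u - 1) *: (e i * (1 - g i)).
Proof. by apply: invlim_ext => r; exact: yok_quadratic. Qed.

Lemma yinf_e_idem i : e i * e i = e i.
Proof.
apply: invlim_ext => r; rewrite yinfM /= -rmorphM framed_idem_idem //.
by rewrite -(exp1n r.+1) ltn_exp2r // prime_gt1.
Qed.

Lemma yinf_gV_poly i : gV i = u^-1 *: (g i ^+ 2 - 1) + g i.
Proof.
exact: quadratic_inv u0 (yinf_e_idem i) (yinf_quadratic i) (yinf_gK p u i).
Qed.

(** The innermost conjugation carries the framing generator of the first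
    strand to the second one, and each further conjugation moves it one strand
    to the right, up to strand i. *)
Lemma yinf_prod_conj i :
  (\prod_(j <- rev (enum 'I_n.-1) | (j < i)%N) g j) * t (Ordinal n_gt0) *
  (\prod_(j <- enum 'I_n.-1 | (j < i)%N) gV j) = t (strand i).
Proof.
rewrite -big_filter -[X in _ * X]big_filter filter_rev.
case: i => k /=; elim: k => [|k IHk] kn.
  rewrite (eq_filter (a2 := pred0)) // filter_pred0 /rev /= !big_nil.
  rewrite mul1r mulr1.
  by congr t; exact: val_inj.
pose i : 'I_n.-1 := Ordinal (ltnW kn).
rewrite (filter_enum_ord_ltnS i) rev_rcons big_cons -cats1 big_cat big_seq1 /=.
have assoc (a b c x y : Y) : a * x * b * (y * c) = a * (x * b * y) * c.
  by rewrite !mulrA.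
rewrite assoc (IHk (ltnW kn)) yinf_g_conj.
by congr t; rewrite /transp (_ : strand _ = strand i) ?tpermL; exact: val_inj.
Qed.

Let S : set Y := [set 1; t (Ordinal n_gt0)] `|` range g.

Lemma yinf_g_gen i : gen_subalg S (g i).
Proof. by apply: gen_subalg_sub; right; exists i. Qed.

Lemma yinf_gV_gen i : gen_subalg S (gV i).
Proof.
rewrite yinf_gV_poly; apply: gen_subalgP (yinf_g_gen i).
rewrite addrC -scaleN1r; apply: gen_subalgP; first exact: gen_subalg1.
by apply: gen_subalgX; exact: yinf_g_gen.
Qed.

Lemma yinf_t_gen j : gen_subalg S (t j).
Proof.
case: j => k; elim: k => [|k IHk] kn.
  by apply: gen_subalg_sub; left; right; congr t; exact: val_inj.
have kn1 : (k < n.-1)%N by rewrite ltn_predRL.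
pose i := Ordinal kn1.
have -> : Ordinal kn = transp i (strand i).
  by rewrite tpermL; exact: val_inj.
rewrite -yinf_g_conj; apply: gen_subalgM (yinf_gV_gen i).
apply: gen_subalgM (yinf_g_gen i) _.
by have := IHk (ltnW kn); congr (gen_subalg S (t _)); exact: val_inj.
Qed.

Lemma yinf_gen_level r (x : Y) : exists2 z, gen_subalg S z & (z : Y) r = x r.
Proof.
elim/yok_span: (x r) => [|a _ _ [z Sz <-] [z' Sz' <-]|].
- by exists 0 => //; exact: gen_subalg0.
- by exists (a *: z + z') => //; exact: gen_subalgP.
apply: framed_ind => [|h h' [z Sz zh] [z' Sz' zh']|j|i|i].
- by exists 1; [exact: gen_subalg1 | rewrite yok_elt1].
- by exists (z * z'); [exact: gen_subalgM | rewrite yok_eltM -zh -zh'].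
- by exists (t j); first exact: yinf_t_gen.
- by exists (g i); first exact: yinf_g_gen.
- by exists (gV i); first exact: yinf_gV_gen.
Qed.
End YokonumaInf.

Theorem theorem3 (R : realType) (p : nat) (p_prime : prime p)
    (u : R[i]) (u_neq0 : u != 0) (n : nat) (n_gt0 : (0 < n)%N) :
  let t1 : yokonuma_inf p n u := yinf_t p u (Ordinal n_gt0) in
  let g (i : 'I_n.-1) : yokonuma_inf p n u := yinf_g p u i in
  let gV (i : 'I_n.-1) : yokonuma_inf p n u := yinf_gV p u i in
  let e (i : 'I_n.-1) : yokonuma_inf p n u := yinf_e p u i in
  topological_generators ([set 1; t1] `|` range g) /\
  [/\ (forall i j : 'I_n.-1, (i.+1 < j)%N \/ (j.+1 < i)%N ->
         g i * g j = g j * g i) /\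
      (forall i j : 'I_n.-1, j = i.+1 :> nat ->
         g i * g j * g i = g j * g i * g j),
      forall i : 'I_n.-1, (0 < i)%N -> t1 * g i = g i * t1,
      forall i : 'I_n.-1, i = 0%N :> nat ->
        t1 * g i * t1 * gV i = g i * t1 * gV i * t1,
      forall i : 'I_n.-1,
        let c := (\prod_(j <- rev (enum 'I_n.-1) | (j < i)%N) g j) * t1 *
                 (\prod_(j <- enum 'I_n.-1 | (j < i)%N) gV j) in
        g i * c * gV i = gV i * c * g i &
      forall i : 'I_n.-1, g i ^+ 2 = 1 + (u - 1) *: (e i * (1 - g i))].
Proof.
move=> t1 g gV e; split.
  by apply: dense_of_levelwise => r x; exact: yinf_gen_level.
split; first by split=> i j; [exact: yinf_g_comm | exact: yinf_g_braid].
- move=> i i_gt0; rewrite /g /t1 yinf_g_t tpermD //.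
  by apply/eqP=> /(congr1 val) /= i0; rewrite i0 in i_gt0.
- move=> i _; rewrite yinf_g_conj [RHS]yinf_tC.
  by rewrite -!mulrA (mulrA (g i)) yinf_g_conj.
- by move=> i c; rewrite /c yinf_prod_conj yinf_g_conj yinf_gV_conj.
- exact: yinf_quadratic.
Qed.
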